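(* Let $n\ge 1$ and $\mu,\mu_c,\kappa>0$. Let $X_0\in\mathrm{GL}^+(n)$ and $M_0\in\mathbb{R}^{n\times n}$. Then the curve $X\colon\mathbb{R}\to\mathrm{GL}^+(n)$ with $$X(t)=X_0\,\exp\!\Big(t\big(\mathrm{sym}(X_0^{-1}M_0)-\tfrac{\mu_c}{\mu}\,\mathrm{skew}(X_0^{-1}M_0)\big)\Big)\,\exp\!\Big(t\big(1+\tfrac{\mu_c}{\mu}\big)\,\mathrm{skew}(X_0^{-1}M_0)\Big)$$ is the unique global solution to the geodesic initial value problem $$U=X^{-1}\dot X,\qquad \dot U=\frac{1+\frac{\mu_c}{\mu}}{2}\,(U^TU-UU^T),\qquad X(0)=X_0,\quad \dot X(0)=M_0 .$$
   Context: $\mathrm{GL}^+(n)$ is the set of real $n\times n$ matrices with positive determinant; $\exp$ is the matrix exponential. For $M\in\mathbb{R}^{n\times n}$, $\mathrm{sym}\,M=\tfrac12(M+M^T)$ and $\mathrm{skew}\,M=\tfrac12(M-M^T)$. A dot denotes the derivative with respect to $t$. A global solution is a twice differentiable curve $X\colon\mathbb{R}\to\mathrm{GL}^+(n)$ satisfying the equations for all $t\in\mathbb{R}$. *)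

(* Defs.v *)
From mathcomp Require Export all_boot all_order all_algebra.
From mathcomp Require Export all_classical all_reals all_analysis.

Set Implicit Arguments.
Unset Strict Implicit.
Unset Printing Implicit Defensive.

Import Order.TTheory GRing.Theory Num.Theory.
Import numFieldNormedType.Exports.

Local Open Scope classical_set_scope.
Local Open Scope ring_scope.

Definition GLplus (R : realType) (n : nat) : set 'M[R]_n :=
  [set A | 0 < \det A].

Definition sympart (R : realType) (n : nat) (M : 'M[R]_n) : 'M[R]_n :=
  2^-1 *: (M + M^T).

Definition skewpart (R : realType) (n : nat) (M : 'M[R]_n) : 'M[R]_n :=
  2^-1 *: (M - M^T).

(* The limit is taken for the max-entry norm on matrices. *)
Definition expmx (R : realType) (n : nat) (A : 'M[R]_n) : 'M[R]_n :=
  limn (series (fun k : nat => (k`!%:R)^-1 *: (A ^+ k) : 'M[R]_n)).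

Definition body_velocity (R : realType) (n : nat) (X : R -> 'M[R]_n)
    (t : R) : 'M[R]_n :=
  invmx (X t) *m (X^`())%classic t.

(* [derive1] is a total operator, so differentiability is required separately;
   for a twice differentiable curve of invertible matrices, the velocity [U]
   is differentiable as well. *)
Record global_geodesic_solution (R : realType) (n : nat) (mu mu_c : R)
    (X0 M0 : 'M[R]_n) (X : R -> 'M[R]_n) : Prop := GlobalGeodesicSolution {
  ggs_GLplus : forall t : R, GLplus (X t);
  ggs_derivable1 : forall t : R, derivable X t 1;
  ggs_derivable2 : forall t : R, derivable (X^`())%classic t 1;
  ggs_equation : let U := body_velocity X in
    forall t : R,
      (U^`())%classic t = ((1 + mu_c / mu) / 2) *: ((U t)^T *m U t - U t *m (U t)^T);
  ggs_position0 : X 0 = X0;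
  ggs_velocity0 : (X^`())%classic 0 = M0
}.

Definition geodesic_curve (R : realType) (n : nat) (mu mu_c : R)
    (X0 M0 : 'M[R]_n) (t : R) : 'M[R]_n :=
  let V := invmx X0 *m M0 in
  X0 *m expmx (t *: (sympart V - (mu_c / mu) *: skewpart V))
     *m expmx ((t * (1 + mu_c / mu)) *: skewpart V).

(* Main.v *)
Require Import Defs.
From mathcomp Require Import ring.

(* The skew part of [U] is conserved, because the right-hand side of the
   equation is symmetric. Along a solution the equation is therefore linear:
   [U' = U B - B U] with [V = X0^-1 M0] and [B = (1 + mu_c / mu) skew V], so
   that [U = exp(-tB) V exp(tB)]. With [A = V - B], the equation [X' = X U]
   then says that [X exp(-tB) exp(-tA)] is constant. Both steps only use that
   a curve with zero derivative is constant, so no uniqueness theorem for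
   differential equations is needed. *)

Set Implicit Arguments.
Unset Strict Implicit.
Unset Printing Implicit Defensive.

Import Order.TTheory GRing.Theory Num.Theory.
Import numFieldNormedType.Exports.

Local Open Scope classical_set_scope.
Local Open Scope ring_scope.

(** * Limits and derivatives of matrix-valued functions *)

Lemma cvg_mx (R : realFieldType) (m n : nat) (T : Type) (F : set_system T)
    {FF : Filter F} (M : T -> 'M[R]_(m, n)) (L : 'M[R]_(m, n)) :
  (forall i j, M x i j @[x --> F] --> L i j) -> M x @[x --> F] --> L.
Proof.
move=> ML; apply/cvgrPdist_le => /= e e0.
near=> x.
rewrite /Num.Def.normr/= mx_normrE (bigmax_le _ (ltW e0))//= => i _.
(* There are finitely many entries, so the entrywise estimates hold simultaneously along the
   filter. *)
rewrite !mxE; move: i; near: x; apply: filter_forall => /= i.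
exact: ((cvgrPdist_le _ _).1 (ML i.1 i.2)).
Unshelve. all: by end_near. Qed.

Lemma cvg_mx_entry (R : realFieldType) (m n : nat) (T : Type)
    (F : set_system T) {FF : Filter F} (M : T -> 'M[R]_(m, n))
    (L : 'M[R]_(m, n)) i j :
  M x @[x --> F] --> L -> M x i j @[x --> F] --> L i j.
Proof.
move=> ML.
exact: (cvg_comp M (fun A => A i j) ML (@coord_continuous _ _ _ i j L)).
Qed.

Section matrix_derivative.
Context {R : realFieldType}.

Lemma is_derive_mxP (m n : nat) (X : R -> 'M[R]_(m, n)) (t : R)
    (D : 'M[R]_(m, n)) :
  is_derive t 1 X D <-> forall i j, is_derive t 1 (fun s => X s i j) (D i j).
Proof.
split=> [[dX <-] i j|dX].
  apply: DeriveDef; first by move/derivable_mxP : dX.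
  by rewrite derive_mx// mxE.
have dX' : derivable X t 1 by apply/derivable_mxP => i j; have [] := dX i j.
apply: DeriveDef => //; rewrite derive_mx//; apply/matrixP => i j.
by rewrite mxE; have [_ ->] := dX i j.
Qed.

Lemma is_derive_mulmx (m n p : nat) (X : R -> 'M[R]_(m, n))
    (Y : R -> 'M[R]_(n, p)) (t : R) (DX : 'M[R]_(m, n)) (DY : 'M[R]_(n, p)) :
  is_derive t 1 X DX -> is_derive t 1 Y DY ->
  is_derive t 1 (fun s => X s *m Y s) (DX *m Y t + X t *m DY).
Proof.
move=> /is_derive_mxP dX /is_derive_mxP dY; apply/is_derive_mxP => i j.
under eq_fun do rewrite mxE.
rewrite (_ : (fun _ => _) = \sum_k ((X ^~ i ^~ k) * (Y ^~ k ^~ j))); last first.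
  by apply/funext => s; rewrite fct_sumE.
apply: (is_derive_eq (is_derive_sum (fun k => is_deriveM (dX i k) (dY k j)))).
rewrite !mxE -big_split/=; apply: eq_bigr => k _.
by rewrite /GRing.scale/= addrC [Y t k j * _]mulrC.
Qed.

Lemma is_derive_trmx (m n : nat) (X : R -> 'M[R]_(m, n)) (t : R)
    (D : 'M[R]_(m, n)) :
  is_derive t 1 X D -> is_derive t 1 (fun s => (X s)^T) D^T.
Proof.
move=> /is_derive_mxP dX; apply/is_derive_mxP => i j.
by under eq_fun do rewrite mxE; rewrite mxE.
Qed.

(** By the Leibniz expansion the determinant is a polynomial in the entries. *)
Lemma derivable_det (n : nat) (X : R -> 'M[R]_n) (t : R) :
  derivable X t 1 -> derivable (fun s => \det (X s)) t 1.
Proof.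
move=> /derivable_mxP dX; rewrite /determinant.
have dM (I : Type) (r : seq I) (f : I -> R -> R) :
    (forall i, derivable (f i) t 1) ->
    derivable (fun s => \prod_(i <- r) f i s) t 1.
  move=> df; elim: r => [|a r IHr].
    by under eq_fun do rewrite big_nil; exact: derivable_cst.
  by under eq_fun do rewrite big_cons; apply: (derivableM (df a)).
have dD (I : Type) (r : seq I) (f : I -> R -> R) :
    (forall i, derivable (f i) t 1) ->
    derivable (fun s => \sum_(i <- r) f i s) t 1.
  move=> df; elim: r => [|a r IHr].
    by under eq_fun do rewrite big_nil; exact: derivable_cst.
  by under eq_fun do rewrite big_cons; apply: (derivableD (df a)).
apply: dD => p; apply: derivableM; first exact: derivable_cst.
exact: dM.
Qed.

(** Cramer's rule: each entry of the inverse is a cofactor divided by a nonvanishing determinant.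
    This yields differentiability of the body velocity of an arbitrary solution. *)
Lemma derivable_invmx (n : nat) (X : R -> 'M[R]_n) (t : R) :
  (forall s, X s \in unitmx) -> derivable X t 1 ->
  derivable (fun s => invmx (X s)) t 1.
Proof.
move=> uX dX; apply/derivable_mxP => i j.
under eq_fun do rewrite /invmx uX !mxE.
apply: derivableM.
  apply: derivableV; first by rewrite -unitfE -unitmxE.
  exact: derivable_det.
apply: derivableM; first exact: derivable_cst.
apply: derivable_det; apply/derivable_mxP => k l.
under eq_fun do rewrite !mxE.
exact: ((derivable_mxP X t 1).1 dX).
Qed.

End matrix_derivative.

Lemma cvg_mulmx (R : realFieldType) (m n p : nat) (T : Type)
    (F : set_system T) {FF : Filter F} (M : T -> 'M[R]_(m, n))
    (N : T -> 'M[R]_(n, p)) (K : 'M[R]_(m, n)) (L : 'M[R]_(n, p)) :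
  M x @[x --> F] --> K -> N x @[x --> F] --> L ->
  M x *m N x @[x --> F] --> K *m L.
Proof.
move=> MK NL; apply: cvg_mx => i j.
under eq_cvg do rewrite mxE; rewrite mxE.
suff MN (r : seq 'I_n) : \sum_(k <- r) M x i k * N x k j @[x --> F] -->
    \sum_(k <- r) K i k * L k j by exact: MN.
elim: r => [|k r IHr].
  by under eq_cvg do rewrite big_nil; rewrite big_nil; exact: cvg_cst.
under eq_cvg do rewrite big_cons; rewrite big_cons.
by apply: cvgD => //; apply: cvgM; exact: cvg_mx_entry.
Qed.

Lemma is_derive_mx0_cst (R : realType) (m n : nat) (X : R -> 'M[R]_(m, n)) :
  (forall t : R, is_derive t (1 : R) X 0) -> forall s t, X s = X t.
Proof.
move=> dX s t; apply/matrixP => i j.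
apply: (@is_derive_0_is_cst _ (fun s => X s i j)) => u.
by have /is_derive_mxP/(_ i j) := dX u; rewrite mxE.
Qed.

(** * The exponential series of a matrix and its derivative *)

Section matrix_exponential.
Context {R : realType} {n : nat}.
Implicit Types A B : 'M[R]_n.

(** The sum of the absolute values of all entries dominates every row sum, so each further factor
    [A] costs at most one factor of it. *)
Lemma normr_exprmx_le A (k : nat) i j :
  `|(A ^+ k) i j| <= (\sum_a \sum_b `|A a b|) ^+ k.
Proof.
elim: k i j => [|k IHk] i j.
  by rewrite !expr0 mxE; case: eqP; rewrite ?normr1// normr0.
rewrite exprS mxE (le_trans (ler_norm_sum _ _ _))//.
apply: (@le_trans _ _ (\sum_b `|A i b| * (\sum_a \sum_b `|A a b|) ^+ k)).
  by apply: ler_sum => b _; rewrite normrM ler_wpM2l.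
rewrite -mulr_suml exprS ler_wpM2r//.
  by apply: exprn_ge0; do 2 apply: sumr_ge0 => ? _.
rewrite [leRHS](bigD1 i)//= lerDl.
by do 2 apply: sumr_ge0 => ? _.
Qed.

(* The shift [d] covers the termwise derivatives of the exponential series. *)
Lemma is_cvg_exprmx_pseries A i j (d : nat) (x : R) :
  cvgn (pseries (fun k => (A ^+ (k + d)) i j / k`!%:R) x).
Proof.
pose S : R := \sum_a \sum_b `|A a b|.
apply: normed_cvg.
(* Comparison with [S ^+ d] times the scalar exponential series at [S * |x|]. *)
apply: (@series_le_cvg _ _ (S ^+ d *: exp_coeff (S * `|x|))) => [k|k|k|].
- exact: normr_ge0.
- rewrite mulr_ge0// ?exprn_ge0 ?divr_ge0//.
    by do 2 apply: sumr_ge0 => ? _.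
  by rewrite exprn_ge0// mulr_ge0//; do 2 apply: sumr_ge0 => ? _.
- rewrite /= !normrM normfV normr_nat normrX.
  rewrite [leRHS](_ : _ = S ^+ (k + d) / k`!%:R * `|x| ^+ k); last first.
    transitivity (S ^+ d * ((S * `|x|) ^+ k / k`!%:R)) => //.
    by rewrite exprMn exprD; ring.
  by rewrite !ler_wpM2r// ?invr_ge0// normr_exprmx_le.
- exact/is_cvg_seriesZ/is_cvg_series_exp_coeff.
Qed.

Lemma scalemxX (t : R) A k : (t *: A) ^+ k = t ^+ k *: A ^+ k.
Proof.
elim: k => [|k IHk]; first by rewrite !expr0 scale1r.
by rewrite !exprS IHk -!mulmxE -scalemxAl -scalemxAr scalerA.
Qed.

Lemma trmxX A k : (A ^+ k)^T = A^T ^+ k.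
Proof.
elim: k => [|k IHk]; first by rewrite !expr0 trmx1.
by rewrite exprS exprSr -!mulmxE trmx_mul IHk.
Qed.

(** Brings the theory of scalar power series to bear on each entry. *)
Lemma series_expmxE A (t : R) N i j :
  series (fun k => (k`!%:R)^-1 *: (t *: A) ^+ k) N i j =
  pseries (fun k => (A ^+ k) i j / k`!%:R) t N.
Proof.
rewrite /pseries /series/= summxE; apply: eq_bigr => k _.
by rewrite scalemxX !mxE mulrCA mulrC; congr (_ * _); rewrite mulrC.
Qed.

(** [limn] is total, so [expmx A] is known to be a limit only once convergence is proved; entrywise
    it is a power series at 1. *)
Lemma cvg_expmx A :
  series (fun k => (k`!%:R)^-1 *: A ^+ k) N @[N --> \oo] --> expmx A.
Proof.
have h : cvgn (series (fun k => (k`!%:R)^-1 *: A ^+ k)).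
  apply/cvg_ex; exists (\matrix_(i, j)
    limn (pseries (fun k => (A ^+ k) i j / k`!%:R) 1)).
  apply: cvg_mx => i j; rewrite mxE -[A]scale1r.
  under eq_cvg do rewrite series_expmxE.
  by rewrite scale1r; have := @is_cvg_exprmx_pseries A i j 0 1;
    under eq_fun do rewrite addn0.
exact: h.
Qed.

Lemma expmx_comm A B : B *m A = A *m B -> B *m expmx A = expmx A *m B.
Proof.
move=> AB.
have hausM := @norm_hausdorff R 'M[R]_n.
rewrite -(cvg_lim hausM (cvg_mulmx (cvg_cst B) (@cvg_expmx A))).
rewrite -(cvg_lim hausM (cvg_mulmx (@cvg_expmx A) (cvg_cst B))).
congr (lim (_ @ \oo)); apply/funext => N.
rewrite /series/= mulmx_suml mulmx_sumr; apply: eq_bigr => k _.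
rewrite -scalemxAl -scalemxAr; congr (_ *: _).
by rewrite !mulmxE; apply: commrX.
Qed.

Lemma expmx_tr A : (expmx A)^T = expmx A^T.
Proof.
apply/matrixP => i j; rewrite mxE.
have hausR := @norm_hausdorff R R.
rewrite -(cvg_lim hausR (cvg_mx_entry (i := j) (j := i) (@cvg_expmx A))).
rewrite -(cvg_lim hausR (cvg_mx_entry (i := i) (j := j) (@cvg_expmx A^T))).
congr (lim (_ @ \oo)); apply/funext => N.
rewrite /series/= !summxE; apply: eq_bigr => k _.
by rewrite -trmxX !mxE.
Qed.

Lemma expmx0 : expmx (0 : 'M[R]_n) = 1%:M.
Proof.
apply: cvg_lim; first exact: norm_hausdorff.
(* The partial sum of index 0 is empty; from index 1 on they all equal the identity. *)
apply: cvg_near_cst; exists 1%N => // -[//|N] _.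
rewrite /series/= big_nat_recl// expr0 fact0 invr1 scale1r big1 ?addr0// => k _.
by rewrite exprS mul0r scaler0.
Qed.

(** Termwise differentiation of the power series of each entry. *)
Lemma is_derive_expmx A (t : R) :
  is_derive t (1 : R) (fun s => expmx (s *: A)) (A *m expmx (t *: A)).
Proof.
apply/is_derive_mxP => i j.
have hausR := @norm_hausdorff R R.
pose c k : R := (A ^+ k) i j / k`!%:R.
(* The [d]-th formal derivative of the series only shifts the power of [A] by [d]. *)
have cE d : iter d (@pseries_diffs R) c =
    fun k => (A ^+ (k + d)) i j / k`!%:R.
  elim: d => [|d IHd]; first by apply/funext => k; rewrite addn0.
  apply/funext => k; rewrite iterS IHd /pseries_diffs/= addSnnS factS natrM.
  by rewrite mulrCA invfM mulVKf.
have cvg_c d x : cvgn (pseries (iter d (@pseries_diffs R) c) x).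
  by rewrite cE; exact: is_cvg_exprmx_pseries.
have cexp (s : R) : expmx (s *: A) i j = limn (pseries c s).
  rewrite -(cvg_lim hausR (cvg_mx_entry (i := i) (j := j) (@cvg_expmx _))).
  by congr (lim (_ @ \oo)); apply/funext => N; exact: series_expmxE.
under eq_fun do rewrite cexp.
(* Termwise differentiation at [t] asks for convergence of the series and its first two formal
   derivatives at a point of larger modulus; [|t| + 1] serves. *)
have tK : `|t| < `| `|t| + 1 |.
  by rewrite [ltRHS]ger0_norm ?addr_ge0// ltrDl.
have := pseries_snd_diffs (cvg_c 0%N _) (cvg_c 1%N _) (cvg_c 2%N _) tK.
move/is_derive_eq; apply; apply/esym.
rewrite -(cvg_lim hausR (cvg_mx_entry (i := i) (j := j)
  (cvg_mulmx (cvg_cst A) (@cvg_expmx (t *: A))))).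
congr (lim (_ @ \oo)); apply/funext => N.
rewrite -[pseries_diffs c]/(iter 1 (@pseries_diffs R) c) cE mxE.
under eq_bigr do rewrite series_expmxE /pseries /series/= mulr_sumr.
rewrite exchange_big/= /pseries /series; apply: eq_bigr => k _.
rewrite /= addn1 exprS mxE 2!mulr_suml; apply: eq_bigr => l _.
by rewrite !mulrA.
Qed.

End matrix_exponential.

(** * Inverse and determinant of the matrix exponential *)

Lemma mulmx_expmxC (R : realType) (n : nat) (A : 'M[R]_n) (t : R) :
  A *m expmx (t *: A) = expmx (t *: A) *m A.
Proof. by apply: expmx_comm; rewrite -scalemxAl scalemxAr. Qed.

(** The product has zero derivative in [t], because [A] commutes with its exponential, and is the
    identity at 0. *)
Lemma mulmx_expmxNl (R : realType) (n : nat) (A : 'M[R]_n) (t : R) :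
  expmx (t *: - A) *m expmx (t *: A) = 1%:M.
Proof.
rewrite (@is_derive_mx0_cst _ _ _ (fun s => expmx (s *: - A) *m expmx (s *: A))
  _ t 0); first by rewrite !scale0r expmx0 mulmx1.
move=> s.
apply: (is_derive_eq
  (is_derive_mulmx (is_derive_expmx (- A) s) (is_derive_expmx A s))).
by rewrite mulmx_expmxC mulmxN mulNmx mulmxA addNr.
Qed.

Lemma mulmx_expmxNr (R : realType) (n : nat) (A : 'M[R]_n) (t : R) :
  expmx (t *: A) *m expmx (t *: - A) = 1%:M.
Proof. by have := mulmx_expmxNl (- A) t; rewrite opprK. Qed.

Lemma unitmx_expmx (R : realType) (n : nat) (A : 'M[R]_n) (t : R) :
  expmx (t *: A) \in unitmx.
Proof. by have [] := mulmx1_unit (mulmx_expmxNr A t). Qed.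

Lemma expmx_double (R : realType) (n : nat) (A : 'M[R]_n) (t : R) :
  expmx (t *: A) *m expmx (t *: A) = expmx (t *: (A + A)).
Proof.
pose E (s : R) := expmx (s *: A).
suff EE1 : E t *m E t *m expmx (t *: - (A + A)) = 1%:M.
  by rewrite -[LHS]mulmx1 -(mulmx_expmxNl (A + A) t) mulmxA EE1 mul1mx.
rewrite (@is_derive_mx0_cst _ _ _
  (fun s => E s *m E s *m expmx (s *: - (A + A))) _ t 0).
  by rewrite /E !scale0r expmx0 !mulmx1.
move=> s; have dE := is_derive_expmx A s.
apply: (is_derive_eq (is_derive_mulmx (is_derive_mulmx dE dE)
  (is_derive_expmx (- (A + A)) s))).
rewrite /E [X in _ + X]mulmxA -mulmxDl -[RHS](mul0mx _ (expmx (s *: - (A + A)))).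
congr (_ *m _); rewrite mulmxN mulmxDr mulmx_expmxC -!mulmxA.
by rewrite mulmx_expmxC subrr.
Qed.

(** The exponential is the square of an invertible matrix, the exponential of half the argument. *)
Lemma det_expmx_gt0 (R : realType) (n : nat) (A : 'M[R]_n) (t : R) :
  0 < \det (expmx (t *: A)).
Proof.
have -> : A = 2^-1 *: A + 2^-1 *: A.
  by rewrite -scalerDl -[LHS]scale1r; congr (_ *: _); field.
have := unitmx_expmx (2^-1 *: A) t.
rewrite -expmx_double det_mulmx -expr2 unitmxE unitfE lt0r sqr_ge0 sqrf_eq0.
by move=> ->.
Qed.

(** * The equations for the body velocity and for the curve *)

Lemma skewpart_bracket (R : realType) (n : nat) (U : 'M[R]_n) (c : R) :
  U *m (c *: skewpart U) - (c *: skewpart U) *m U =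
  (c / 2) *: (U^T *m U - U *m U^T).
Proof.
rewrite /skewpart !scalerA -scalemxAr -scalemxAl -scalerBr; congr (_ *: _).
(* The two terms [U *m U] cancel. *)
by rewrite mulmxBr mulmxBl opprB addrC subrKA.
Qed.

Lemma tr_skewpart (R : realType) (n : nat) (V : 'M[R]_n) :
  (skewpart V)^T = - skewpart V.
Proof. by apply/matrixP => i j; rewrite !mxE; ring. Qed.

(** Symmetry of the right-hand side is what makes the skew part of [U] a conserved quantity. *)
Lemma tr_bracket (R : realType) (n : nat) (U : 'M[R]_n) (c : R) :
  (c *: (U^T *m U - U *m U^T))^T = c *: (U^T *m U - U *m U^T).
Proof. by rewrite linearZ/= linearB/= !trmx_mul trmxK. Qed.

Section geodesic.
Context {R : realType} {n : nat}.
Variables (c : R) (V A B : 'M[R]_n).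
Hypotheses (BE : B = c *: skewpart V) (addAB : A + B = V).

(** Since [B] is skew, its exponential is orthogonal. *)
Let tr_expB t : (expmx (t *: B))^T = expmx (t *: - B).
Proof. by rewrite expmx_tr BE 2!linearZ/= tr_skewpart !scalerN. Qed.

Lemma is_derive_geodesic (X0 : 'M[R]_n) (t : R) :
  is_derive t (1 : R) (fun s => X0 *m expmx (s *: A) *m expmx (s *: B))
    (X0 *m expmx (t *: A) *m V *m expmx (t *: B)).
Proof.
apply: (is_derive_eq (is_derive_mulmx (is_derive_mulmx
  (is_derive_cst X0 t (1 : R)) (is_derive_expmx A t)) (is_derive_expmx B t))).
(* Moving [A] past its own exponential puts [A] and [B] side by side, where they add up to [V]. *)
by rewrite mul0mx add0r mulmx_expmxC [_ *m (B *m _)]mulmxA mulmxA -mulmxDl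
  -mulmxDr addAB.
Qed.

(** Differentiation gives the conjugate of [V *m B - B *m V], which is the bracket of [V].
    Conjugation by an orthogonal matrix respects products and transposes, so this is the bracket of
    [U t]. *)
Lemma is_derive_conj_expmx (t : R) :
  let U s := expmx (s *: - B) *m V *m expmx (s *: B) in
  is_derive t (1 : R) U ((c / 2) *: ((U t)^T *m U t - U t *m (U t)^T)).
Proof.
move=> U.
apply: (is_derive_eq (is_derive_mulmx (is_derive_mulmx (is_derive_expmx (- B) t)
  (is_derive_cst V t (1 : R))) (is_derive_expmx B t))).
rewrite mulmx0 addr0 mulmx_expmxC.
have conjM P Q : expmx (t *: - B) *m P *m expmx (t *: B) *m
    (expmx (t *: - B) *m Q *m expmx (t *: B)) =
    expmx (t *: - B) *m (P *m Q) *m expmx (t *: B).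
  rewrite -!mulmxA; congr (_ *m (_ *m _)).
  by rewrite mulmxA mulmx_expmxNr mul1mx.
have trU : (U t)^T = expmx (t *: - B) *m V^T *m expmx (t *: B).
  by rewrite /U !trmx_mul tr_expB -[expmx (t *: - B)]tr_expB trmxK mulmxA.
rewrite trU !conjM -mulmxBl -mulmxBr scalemxAl scalemxAr -skewpart_bracket -BE.
rewrite mulmxBr mulmxBl addrC mulmxN !mulNmx; congr (_ - _).
  by rewrite -!mulmxA.
by rewrite -!mulmxA.
Qed.

Lemma body_velocity_unique (U : R -> 'M[R]_n) :
  (forall t : R, is_derive t (1 : R) U
     ((c / 2) *: ((U t)^T *m U t - U t *m (U t)^T))) ->
  U 0 = V -> forall t, U t = expmx (t *: - B) *m V *m expmx (t *: B).
Proof.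
move=> dU U0 t.
(* Conservation of the skew part turns the quadratic equation into a linear one with constant
   [B]. *)
have antisymU s : U s - (U s)^T = V - V^T.
  rewrite -U0; apply: (@is_derive_mx0_cst _ _ _ (fun s => U s - (U s)^T)) => r.
  apply: (is_derive_eq (is_deriveB (dU r) (is_derive_trmx (dU r)))).
  by rewrite tr_bracket subrr.
have {}dU s : is_derive s (1 : R) U (U s *m B - B *m U s).
  apply: (is_derive_eq (dU s)).
  by rewrite -skewpart_bracket BE /skewpart antisymU.
(* Undoing the expected conjugation must leave a constant. *)
have UV : expmx (t *: B) *m U t *m expmx (t *: - B) = V.
  rewrite (@is_derive_mx0_cst _ _ _
    (fun s => expmx (s *: B) *m U s *m expmx (s *: - B)) _ t 0).
    by rewrite !scale0r expmx0 mulmx1 mul1mx.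
  move=> s; apply: (is_derive_eq (is_derive_mulmx
    (is_derive_mulmx (is_derive_expmx B s) (dU s)) (is_derive_expmx (- B) s))).
  rewrite mulmx_expmxC [X in _ + X]mulmxA -mulmxDl.
  rewrite -[RHS](mul0mx _ (expmx (s *: - B))); congr (_ *m _).
  by rewrite mulmxN mulmxBr !mulmxA subrKC subrr.
rewrite -[in RHS]UV -!mulmxA mulmx_expmxNl mulmx1.
by rewrite mulmxA mulmx_expmxNl mul1mx.
Qed.

Lemma geodesic_unique (X : R -> 'M[R]_n) :
  (forall t : R, is_derive t (1 : R) X
    (X t *m (expmx (t *: - B) *m V *m expmx (t *: B)))) ->
  forall t, X t = X 0 *m expmx (t *: A) *m expmx (t *: B).
Proof.
move=> dX t.
have <- : X t *m expmx (t *: - B) *m expmx (t *: - A) = X 0.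
  rewrite (@is_derive_mx0_cst _ _ _
    (fun s => X s *m expmx (s *: - B) *m expmx (s *: - A)) _ t 0).
    by rewrite !scale0r expmx0 !mulmx1.
  move=> s; apply: (is_derive_eq (is_derive_mulmx
    (is_derive_mulmx (dX s) (is_derive_expmx (- B) s))
    (is_derive_expmx (- A) s))).
  rewrite [X in _ + X]mulmxA -mulmxDl.
  rewrite -[RHS](mul0mx _ (expmx (s *: - A))); congr (_ *m _).
  (* After factoring out [X s *m expmx (s *: - B)] on the left, what remains is [V - B - A], which
     is zero. *)
  rewrite mulmx_expmxC -!mulmxA -!mulmxDr mulmx_expmxNr mulmx1.
  by rewrite -addAB -addrA -opprD [B + A]addrC subrr !mulmx0.
by rewrite -!mulmxA [expmx (t *: - A) *m _]mulmxA mulmx_expmxNl mul1mx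
  mulmx_expmxNl mulmx1.
Qed.

End geodesic.

(* Keeps [A], [B] abstract: unifying modulo their definitions blows up. *)
Lemma geodesic_curve_spec (R : realType) (n : nat) (mu mu_c : R)
    (X0 M0 : 'M[R]_n) :
  let V := invmx X0 *m M0 in
  exists A B, [/\ B = (1 + mu_c / mu) *: skewpart V, A + B = V &
    geodesic_curve mu mu_c X0 M0 =
      fun t => X0 *m expmx (t *: A) *m expmx (t *: B)].
Proof.
move=> V; exists (sympart V - (mu_c / mu) *: skewpart V).
exists ((1 + mu_c / mu) *: skewpart V); split; first by [].
  by apply/matrixP => i j; rewrite !mxE; move: (mu_c / mu) => k; field.
by apply/funext => t; rewrite scalerA.
Qed.

(** * Existence and uniqueness of the global solution *)

Lemma geodesic_curve_solution (R : realType) (n : nat) (mu mu_c : R)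
    (X0 M0 : 'M[R]_n) :
  GLplus X0 ->
  global_geodesic_solution mu mu_c X0 M0 (geodesic_curve mu mu_c X0 M0).
Proof.
move=> GLX0.
have uX0 : X0 \in unitmx by rewrite unitmxE unitfE gt_eqF//; exact: GLX0.
have [A [B [BE ABE ->]]] := geodesic_curve_spec mu mu_c X0 M0.
have := mulKVmx uX0 M0.
move: (invmx X0 *m M0) BE ABE => V BE ABE X0V.
set X := fun t => _.
have X_gt0 t : 0 < \det (X t) by rewrite !det_mulmx !mulr_gt0 ?det_expmx_gt0.
have uX t : X t \in unitmx by rewrite unitmxE unitfE gt_eqF.
have dX t : is_derive t (1 : R) X (X0 *m expmx (t *: A) *m V *m expmx (t *: B)).
  exact: is_derive_geodesic.
have dXE : X^`()%classic =
    fun t => X0 *m expmx (t *: A) *m V *m expmx (t *: B).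
  by apply/funext => t; rewrite derive1E; have [] := dX t.
have UE : body_velocity X =
    fun t => expmx (t *: - B) *m V *m expmx (t *: B).
  apply/funext => t; rewrite /body_velocity dXE.
  (* Both sides are compared after left multiplication by the invertible [X t], which avoids
     computing its inverse. *)
  apply: (can_inj (mulKmx (uX t))); rewrite mulKVmx// /X -!mulmxA.
  by rewrite [expmx (t *: B) *m _]mulmxA mulmx_expmxNr mul1mx.
split.
- exact: X_gt0.
- by move=> t; have [] := dX t.
- move=> t; rewrite dXE.
  by have [] := is_derive_mulmx (is_derive_mulmx (is_derive_mulmx
    (is_derive_cst X0 t (1 : R)) (is_derive_expmx A t))
    (is_derive_cst V t (1 : R))) (is_derive_expmx B t).
- rewrite UE => U t.
  by rewrite derive1E; have [_ ->] := is_derive_conj_expmx BE t.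
- by rewrite /X !scale0r expmx0 !mulmx1.
- by rewrite dXE !scale0r expmx0 !mulmx1.
Qed.

Lemma geodesic_solution_unique (R : realType) (n : nat) (mu mu_c : R)
    (X0 M0 : 'M[R]_n) (X : R -> 'M[R]_n) :
  global_geodesic_solution mu mu_c X0 M0 X ->
  X = geodesic_curve mu mu_c X0 M0.
Proof.
move=> [XGL dX ddX Ueq X_0 dX_0].
have uX t : X t \in unitmx by rewrite unitmxE unitfE gt_eqF//; exact: XGL.
have [A [B [BE ABE ->]]] := geodesic_curve_spec mu mu_c X0 M0.
have U0 : body_velocity X 0 = invmx X0 *m M0.
  by rewrite /body_velocity X_0 dX_0.
have dXU t : is_derive t (1 : R) X (X t *m body_velocity X t).
  apply: DeriveDef; first exact: dX.
  by rewrite /body_velocity (mulKVmx (uX t)) derive1E.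
(* The equation only fixes the value of a total derivative; genuine differentiability of [U] comes
   from that of the inverse and of the velocity of [X]. *)
have dU t : derivable (body_velocity X) t 1.
  have dI := derivable_invmx uX (dX t).
  by have [] := is_derive_mulmx (derivableP dI) (derivableP (ddX t)).
(* From here [U] and [V] are arbitrary, tied to [X] only by the two differential equations and the
   initial value. *)
move: (body_velocity X) (invmx X0 *m M0) Ueq U0 BE ABE dXU dU.
move=> U V Ueq U0 BE ABE dXU dU.
have UE t : U t = expmx (t *: - B) *m V *m expmx (t *: B).
  apply: (body_velocity_unique BE _ U0) => s.
  by apply: DeriveDef; [exact: dU|rewrite -derive1E Ueq].
apply/funext => t; rewrite -X_0; apply: (geodesic_unique ABE) => s.
by rewrite -UE.
Qed.

Unset Implicit Arguments.
Set Strict Implicit.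
Set Printing Implicit Defensive.

Theorem theorem3p1 (R : realType) (n : nat) (mu mu_c kappa : R)
    (X0 M0 : 'M[R]_n) :
  (1 <= n)%N -> 0 < mu -> 0 < mu_c -> 0 < kappa -> GLplus X0 ->
  global_geodesic_solution mu mu_c X0 M0 (geodesic_curve mu mu_c X0 M0) /\
  (forall X : R -> 'M[R]_n,
    global_geodesic_solution mu mu_c X0 M0 X ->
    X = geodesic_curve mu mu_c X0 M0).
Proof.
move=> _ _ _ _ GLX0; split; first exact: geodesic_curve_solution.
exact: geodesic_solution_unique.
Qed.
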